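(* (1) Let $\mathcal{A}$ be an almost disjoint family with $|\mathcal{A}|<\aleph_\omega$. Then $\Psi(\mathcal{A})$ is star-Scheepers if and only if $\Psi(\mathcal{A})$ is strongly star-Scheepers. (2) Let $Y\subseteq\mathbb{R}$ with $|Y|<\aleph_\omega$. Then the Niemytzki plane $N(Y)$ is star-Scheepers if and only if $N(Y)$ is strongly star-Scheepers.
   Context: For $A\subseteq X$ and a family $\mathcal{P}$ of subsets of $X$, $St(A,\mathcal{P})=\bigcup\{B\in\mathcal{P} : A\cap B\neq\emptyset\}$. An $\omega$-cover of $X$ is an open cover $\mathcal{U}$ such that every finite $F\subseteq X$ is contained in some member of $\mathcal{U}$. A space $X$ is star-Scheepers if for each sequence $(\mathcal{U}_n)_{n\in\mathbb{N}}$ of open covers of $X$ there are finite $\mathcal{V}_n\subseteq\mathcal{U}_n$ such that $\{St(\bigcup\mathcal{V}_n,\mathcal{U}_n) : n\in\mathbb{N}\}$ is an $\omega$-cover of $X$ or $St(\bigcup\mathcal{V}_n,\mathcal{U}_n)=X$ for some $n$. $X$ is strongly star-Scheepers if for each sequence $(\mathcal{U}_n)_{n\in\mathbb{N}}$ of open covers of $X$ there are finite sets $F_n\subseteq X$ such that $\{St(F_n,\mathcal{U}_n) : n\in\mathbb{N}\}$ is an $\omega$-cover of $X$. A family $\mathcal{A}\subseteq P(\mathbb{N})$ is almost disjoint if every $A\in\mathcal{A}$ is infinite and $B\cap C$ is finite for distinct $B,C\in\mathcal{A}$ (maximality is not required). The Isbell-Mrówka space is $\Psi(\mathcal{A})=\mathcal{A}\cup\mathbb{N}$,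 where points of $\mathbb{N}$ are isolated and basic neighbourhoods of $A\in\mathcal{A}$ are the sets $\{A\}\cup(A\setminus F)$ with $F\subseteq\mathbb{N}$ finite. For $Y\subseteq\mathbb{R}$, the Niemytzki plane is $N(Y)=(Y\times\{0\})\cup(\mathbb{R}\times(0,\infty))$, where $\mathbb{R}\times(0,\infty)$ is open with the Euclidean topology and basic neighbourhoods of $(y,0)$, $y\in Y$, are the sets $\{(y,0)\}\cup U$ with $U$ an open disc in $\mathbb{R}\times(0,\infty)$ tangent to the horizontal axis at $(y,0)$. *)

(* Defs.v *)
From HB Require Import structures.
From mathcomp Require Import all_boot all_order all_algebra.
From mathcomp Require Import all_classical all_reals all_analysis.
From mathcomp Require Import lra.
Import Order.TTheory GRing.Theory Num.Theory.

Set Implicit Arguments.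
Unset Strict Implicit.
Unset Printing Implicit Defensive.

Local Open Scope classical_set_scope.
Local Open Scope ring_scope.
Local Open Scope card_scope.

Definition card_lt T U (A : set T) (B : set U) : Prop :=
  A #<= B /\ ~ (B #<= A).

(* [B] has the least cardinality above [|A|]. It suffices to test subsets [C]
   of [B], as every cardinal below [|B|] is realised by one; the same remark
   applies to the existential in [is_aleph] and to [is_aleph_omega]. *)
Definition is_succ_card T (A B : set T) : Prop :=
  card_lt A B /\ forall C : set T, C `<=` B -> card_lt A C -> B #<= C.

Fixpoint is_aleph (n : nat) T (B : set T) : Prop :=
  if n is m.+1 then exists A : set T, is_aleph m A /\ is_succ_card A B
  else B #= [set: nat].

Definition above_alephs T (W : set T) : Prop :=
  forall n, exists B : set T, B `<=` W /\ is_aleph n B.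

(* [|W|] is the supremum of the cardinals aleph_n, n < omega *)
Definition is_aleph_omega T (W : set T) : Prop :=
  above_alephs W /\
  forall C : set T, C `<=` W -> above_alephs C -> W #<= C.

Definition card_lt_aleph_omega T (A : set T) : Prop :=
  exists (U : Type) (W : set U), is_aleph_omega W /\ card_lt A W.

Section star_selection.
Context {X : topologicalType}.
Implicit Types (A : set X) (P : set (set X)).

Definition star A P : set X :=
  \bigcup_(B in [set B | P B /\ A `&` B !=set0]) B.

Definition open_cover P : Prop :=
  (forall U, P U -> open U) /\ \bigcup_(U in P) U = setT.

(* [X] itself is allowed to be a member of an omega-cover *)
Definition omega_cover P : Prop :=
  open_cover P /\
  forall F : set X, finite_set F -> exists U, P U /\ F `<=` U.

End star_selection.

Definition star_scheepers (X : topologicalType) : Prop :=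
  forall U : nat -> set (set X), (forall n, open_cover (U n)) ->
  exists V : nat -> set (set X),
    (forall n, V n `<=` U n /\ finite_set (V n)) /\
    (omega_cover (range (fun n => star (\bigcup_(B in V n) B) (U n))) \/
     exists n, star (\bigcup_(B in V n) B) (U n) = setT).

Definition strongly_star_scheepers (X : topologicalType) : Prop :=
  forall U : nat -> set (set X), (forall n, open_cover (U n)) ->
  exists F : nat -> set X,
    (forall n, finite_set (F n)) /\
    omega_cover (range (fun n => star (F n) (U n))).

Definition almost_disjoint (A : set (set nat)) : Prop :=
  (forall B, A B -> infinite_set B) /\
  (forall B C, A B -> A C -> B <> C -> finite_set (B `&` C)).

Variant isbell_mrowka (A : set (set nat)) : Type :=
  | IMset (a : set_type A)
  | IMnat (n : nat).
Arguments IMset {A} a.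
Arguments IMnat {A} n.

Section isbell_mrowka_topology.
Variable A : set (set nat).
Local Notation Psi := (isbell_mrowka A).

Definition isbell_mrowka_basic (x : Psi) (F : set nat) : set Psi :=
  match x with
  | IMset a => IMset a |` IMnat @` (set_val a `\` F)
  | IMnat n => [set IMnat n]
  end.

Definition isbell_mrowka_open (U : set Psi) : Prop :=
  forall x, U x ->
    exists F, finite_set F /\ isbell_mrowka_basic x F `<=` U.

Let isbell_mrowka_openT : isbell_mrowka_open setT.
Proof. by move=> x _; exists set0; split => //; exact: finite_set0. Qed.

Let isbell_mrowka_openI : setI_closed isbell_mrowka_open.
Proof.
move=> U V oU oV x [/oU [F [finF FU]] /oV [G [finG GV]]].
exists (F `|` G); split; first by rewrite finite_setU.
case: x FU GV => [a|n] FU GV y /=.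
  move=> [->|[k [ak /not_orP[nFk nGk]] <-]].
    by split; [apply: FU; left | apply: GV; left].
  by split; [apply: FU | apply: GV]; right; exists k.
by move=> ->; split; [exact: FU | exact: GV].
Qed.

Let isbell_mrowka_open_bigU (I : Type) (f : I -> set Psi) :
  (forall i, isbell_mrowka_open (f i)) -> isbell_mrowka_open (\bigcup_i f i).
Proof.
move=> fo x [i _ /fo [F [finF Ff]]].
by exists F; split => // y /Ff ?; exists i.
Qed.

HB.instance Definition _ := gen_eqMixin Psi.
HB.instance Definition _ := gen_choiceMixin Psi.
HB.instance Definition _ := isOpenTopological.Build Psi
  isbell_mrowka_openT isbell_mrowka_openI isbell_mrowka_open_bigU.

End isbell_mrowka_topology.

Definition euclidean_disc (R : realType) (c : R * R) (r : R) : set (R * R) :=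
  [set q | (q.1 - c.1) ^+ 2 + (q.2 - c.2) ^+ 2 < r ^+ 2].

Record niemytzki (R : realType) (Y : set R) : Type := Niemytzki {
  niemytzki_pt : R * R;
  niemytzki_ptP : 0 < niemytzki_pt.2 \/ (niemytzki_pt.2 = 0 /\ Y niemytzki_pt.1)
}.

Section niemytzki_topology.
Variables (R : realType) (Y : set R).
Local Notation N := (niemytzki Y).
Local Notation pt := (@niemytzki_pt R Y).

(* For [x = (y, 0)], the open disc of radius [r] in the upper half-plane that
   is tangent to the axis at [x] is the one centred at [(y, r)]. *)
Definition niemytzki_basic (x : N) (r : R) : set N :=
  if 0 < (pt x).2 then
    [set z | 0 < (pt z).2 /\ euclidean_disc (pt x) r (pt z)]
  else
    x |` [set z | euclidean_disc ((pt x).1, r) r (pt z)].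

Definition niemytzki_open (U : set N) : Prop :=
  forall x, U x -> exists r : R, 0 < r /\ niemytzki_basic x r `<=` U.

Let niemytzki_basic_le (x : N) (r s : R) : 0 < r -> r <= s ->
  niemytzki_basic x r `<=` niemytzki_basic x s.
Proof.
move=> r0 rs z; have s0 : 0 < s by exact: lt_le_trans rs.
rewrite /niemytzki_basic /euclidean_disc; case: ifPn => _ /=.
  move=> [z0 zr]; split => //; apply: lt_le_trans zr _.
  by rewrite ler_sqr // nnegrE ltW.
move=> [->|zr]; [by left | right].
have z2 : 0 <= (pt z).2 by case: (niemytzki_ptP z) => [/ltW|[->]].
have /mulr_ge0/(_ z2) : 0 <= s - r by rewrite subr_ge0.
by move: zr => /=; nra.
Qed.

Let niemytzki_openT : niemytzki_open setT.
Proof. by move=> x _; exists 1. Qed.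

Let niemytzki_openI : setI_closed niemytzki_open.
Proof.
move=> U V oU oV x [/oU [r [r0 rU]] /oV [s [s0 sV]]].
have m0 : 0 < Num.min r s by rewrite lt_min r0 s0.
exists (Num.min r s); split => // z zm; split.
  by apply: rU; apply: niemytzki_basic_le zm => //; rewrite ge_min lexx.
by apply: sV; apply: niemytzki_basic_le zm => //; rewrite ge_min lexx orbT.
Qed.

Let niemytzki_open_bigU (I : Type) (f : I -> set N) :
  (forall i, niemytzki_open (f i)) -> niemytzki_open (\bigcup_i f i).
Proof.
move=> fo x [i _ /fo [r [r0 rf]]].
by exists r; split => // z /rf ?; exists i.
Qed.

HB.instance Definition _ := gen_eqMixin N.
HB.instance Definition _ := gen_choiceMixin N.
HB.instance Definition _ := isOpenTopological.Build N
  niemytzki_openT niemytzki_openI niemytzki_open_bigU.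

End niemytzki_topology.

(* Main.v *)
Require Import Defs.
From HB Require Import structures.
From mathcomp Require Import all_boot all_order all_algebra.
From mathcomp Require Import all_classical all_reals all_analysis.
From mathcomp Require Import wochoice lra.

(* Both spaces are a sigma-compact set together with a closed discrete set of
   points [e b], and they have a countable dense set [q_0, q_1, ...].  For open
   covers [U_n] let [f_b n] be such that [q_(f_b n)] lies in some member of
   [U_n] around [e b].  If some [g] is not eventually dominated by the maximum of
   [f_b], [b] in [S], for any finite [S], then [{q_k : k < g n}], completed by a
   finite set taking care of the [n]-th compact piece, witnesses that the space
   is strongly star-Scheepers.  Otherwise there is a dominating family indexed
   by the points [e b].  For an uncountable cardinal [aleph_n] the countable
   subsets of [aleph_n] have a cofinal family of size [aleph_n], so each pair (a
   countable set of points from that family, a dominating function) is coded by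
   a point [e b] outside the countable set.  Shrinking the [n]-th neighbourhood
   of [e b] away from the neighbourhoods of the first few points of its code
   defines covers against which every choice of finite subfamilies misses the
   star of some [e b]. *)

Set Implicit Arguments.
Unset Strict Implicit.
Unset Printing Implicit Defensive.

Local Open Scope classical_set_scope.
Local Open Scope card_scope.

(** * Cardinals *)

Lemma card_le_fun (T U : Type) (u : U) (A : set T) (B : set U) :
  A #<= B ->
  exists f : T -> U, (forall x, A x -> B (f x)) /\
    (forall x y, A x -> A y -> f x = f y -> x = y).
Proof.
(* An arbitrary type is given a choice structure, and [u] makes it pointed, so that [pcard_leP]
   applies. *)
elim/Pchoice: U u B => U u B.
pose U' : pointedType := HB.pack U (isPointed.Build U u).
move=> /(@pcard_leP T U' A B)/injfunPex[f fAB fI].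
exists f; split=> [x /fAB//|x y Ax Ay]; apply: fI; exact: mem_set.
Qed.

(** Injections below often arise as graphs. The relation may be multivalued: distinct points share
    no value, so any choice function for it is injective. *)
Lemma card_le_rel (T U : Type) (A : set T) (B : set U) (r : T -> U -> Prop) :
  (forall x, A x -> exists y, B y /\ r x y) ->
  (forall x x' y, A x -> A x' -> r x y -> r x' y -> x = x') ->
  A #<= B.
Proof.
move=> tot inj.
have [->//|/set0P[x0 Ax0]] := eqVneq A set0.
have [u _] := tot _ Ax0.
have tot' x : exists y, A x -> B y /\ r x y.
  by have [/tot[y ?]|nAx] := pselect (A x); [exists y|exists u].
have [f fP] := choice tot'.
elim/Pchoice: U u B r tot inj tot' f fP => U u B r tot inj tot' f fP.
pose U' : pointedType := HB.pack U (isPointed.Build U u).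
apply/(@pcard_leP T U' A B)/injfunPex; exists f => [x /fP[]//|].
move=> x y /set_mem Ax /set_mem Ay e; apply: (inj x y (f x) Ax Ay (proj2 (fP x Ax))).
by rewrite e; exact: (proj2 (fP y Ay)).
Qed.

Lemma card_le_of_inj (T U : Type) (A : set T) (B : set U) (f : T -> U) :
  (forall x, A x -> B (f x)) ->
  (forall x y, A x -> A y -> f x = f y -> x = y) -> A #<= B.
Proof.
move=> fAB fI; apply: (@card_le_rel _ _ _ _ (fun x y => f x = y)).
  by move=> x Ax; exists (f x); split => //; exact: fAB.
by move=> x x' y Ax Ax' <- e; apply: fI.
Qed.

Lemma card_le_setX (T T' U U' : Type) (A : set T) (A' : set T')
    (B : set U) (B' : set U') :
  A #<= B -> A' #<= B' -> A `*` A' #<= B `*` B'.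
Proof.
move=> AB AB'.
have [->//|/set0P[[x0 x0'] [/= Ax0 Ax0']]] := eqVneq (A `*` A') set0.
have [u Bu] : B !=set0.
  by apply/set0P/eqP => B0; rewrite B0 in AB; move/card_le0P: AB Ax0 => ->.
have [u' Bu'] : B' !=set0.
  by apply/set0P/eqP => B0; rewrite B0 in AB'; move/card_le0P: AB' Ax0' => ->.
have [f [fAB fI]] := card_le_fun u AB.
have [g [gAB gI]] := card_le_fun u' AB'.
apply: (@card_le_of_inj _ _ _ _ (fun p => (f p.1, g p.2))).
  by move=> [x y] [/= Ax Ay]; split=> /=; [exact: fAB|exact: gAB].
move=> [x y] [x' y'] [/= Ax Ay] [/= Ax' Ay'] [fe ge].
by rewrite (fI _ _ Ax Ax' fe) (gI _ _ Ay Ay' ge).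
Qed.

Lemma card_le_subset (T U : Type) (A : set T) (B : set U) :
  A #<= B -> exists2 C, C `<=` B & A #= C.
Proof.
move=> AB; have [A0|/set0P[x0 Ax0]] := eqVneq A set0.
  by exists set0 => //; rewrite A0 card_eq00.
have [u Bu] : B !=set0.
  by apply/set0P/eqP => B0; rewrite B0 in AB; move/card_le0P: AB Ax0 => ->.
have [f [fAB fI]] := card_le_fun u AB.
exists (f @` A); first by move=> _ [x Ax <-]; exact: fAB.
rewrite card_esym//; apply: inj_card_eq => x y /set_mem Ax /set_mem Ay.
exact: fI.
Qed.

(** Zorn's lemma on graphs of partial injections: a maximal graph missing some [x0] in [A] and some
    [y0] in [B] could be enlarged by [(x0, y0)]. *)
Lemma card_le_total (T U : Type) (A : set T) (B : set U) : A #<= B \/ B #<= A.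
Proof.
pose P (G : set (T * U)) := G `<=` A `*` B /\
  forall p q, G p -> G q -> (p.1 = q.1 <-> p.2 = q.2).
have [F FP Ftot|G [[GAB GI] Gmax]] := @Zorn_bigcup _ P.
  split; first by move=> p [G FG Gp]; exact: (FP _ FG).1.
  move=> p q [G FG Gp] [H FH Hq].
  have [GH|HG] := Ftot _ _ FG FH.
    by apply: (FP _ FH).2 => //; exact: GH.
  by apply: (FP _ FG).2 => //; exact: HG.
have [Adom|] := pselect (forall x, A x -> exists y, G (x, y)).
  left; apply: (@card_le_rel _ _ _ _ (fun x y => G (x, y))).
    by move=> x /Adom[y Gxy]; exists y; split => //; exact: (GAB _ Gxy).2.
  by move=> x x' y _ _ Gx Gx'; exact: (GI _ _ Gx Gx').2.
move=> /existsNP[x0 /not_implyP[Ax0 nx0]].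
have [Brng|] := pselect (forall y, B y -> exists x, G (x, y)).
  right; apply: (@card_le_rel _ _ _ _ (fun y x => G (x, y))).
    by move=> y /Brng[x Gxy]; exists x; split => //; exact: (GAB _ Gxy).1.
  by move=> y y' x _ _ Gx Gx'; exact: (GI _ _ Gx Gx').1.
move=> /existsNP[y0 /not_implyP[By0 ny0]].
exfalso; apply: (Gmax (G `|` [set (x0, y0)])).
  split; first by move=> p Gp; left.
  by move=> /(_ (x0, y0)) Gxy; apply: nx0; exists y0; apply: Gxy; right.
split; first by move=> p [/GAB//|->].
move=> [x y] [x' y'] [Gp|[-> ->]] [Gq|[-> ->]] //=.
- exact: (GI _ _ Gp Gq).
- split=> e; exfalso.
    by apply: nx0; exists y; rewrite -e.
  by apply: ny0; exists x; rewrite -e.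
- split=> e; exfalso.
    by apply: nx0; exists y'; rewrite e.
  by apply: ny0; exists x'; rewrite e.
Qed.

(** * Absorption laws for infinite cardinals *)

Lemma card_setX_countable (T : Type) (A : set T) :
  A `*` A #<= A -> infinite_set A -> [set: nat] `*` A #<= A.
Proof.
move=> AA /infiniteP nA; apply: card_le_trans AA.
by apply: card_le_setX.
Qed.

Lemma card_setU_le (T : Type) (A B : set T) :
  A `*` A #<= A -> infinite_set A -> B #<= A -> A `|` B #<= A.
Proof.
move=> AA Ainf BA; apply: card_le_trans (card_setX_countable AA Ainf).
have [x0 Ax0] := infinite_setN0 Ainf.
have [f [fBA fI]] := card_le_fun x0 BA.
pose r (x : T) (p : nat * T) := (A x /\ p = (0, x)) \/ (B x /\ p = (1, f x)).
apply: (@card_le_rel _ _ _ _ r).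
  move=> x [Ax|Bx]; first by exists (0, x); split => //; left.
  by exists (1, f x); split; [split => //=; exact: fBA|right].
move=> x x' [i y] _ _ [[Ax [-> ->]]|[Bx [-> ->]]] [[Ax' []]|[Bx' []]] //.
exact: fI.
Qed.

(** By Zorn's lemma there is a maximal partial pairing, with infinite domain [D]. If [A] minus [D]
    embeds in [D], so does [A]. Otherwise [A] minus [D] contains a copy [E] of [D], and sending the
    new pairs of points of the union of [D] and [E] into [E] extends the pairing. *)
Lemma infinite_card_setX (T : Type) (A : set T) :
  infinite_set A -> A `*` A #<= A.
Proof.
move=> Ainf.
pose dom (G : set ((T * T) * T)) : set T := [set x | exists y z, G ((x, y), z)].
(* [G] encodes an injection [dom G `*` dom G -> dom G] *)
pose Q (G : set ((T * T) * T)) :=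
  [/\ dom G `<=` A,
      forall x y z, G ((x, y), z) -> dom G y /\ dom G z,
      forall x y, dom G x -> dom G y -> exists z, G ((x, y), z) &
      forall p q z, G (p, z) -> G (q, z) -> p = q].
pose P G := Q G /\ (G = set0 \/ infinite_set (dom G)).
have domS G H : G `<=` H -> dom G `<=` dom H.
  by move=> GH x [y [z Gx]]; exists y, z; exact: GH.
have [F FP Ftot|G [[QG Ginf] Gmax]] := @Zorn_bigcup _ P.
  have domU x : dom (\bigcup_(G in F) G) x <-> exists2 G, F G & dom G x.
    split=> [[y [z [G FG Gx]]]|[G FG [y [z Gx]]]]; first by exists G => //; exists y, z.
    by exists y, z, G.
  have common G H : F G -> F H -> exists2 K, F K & G `<=` K /\ H `<=` K.
    by move=> FG FH; have [GH|HG] := Ftot _ _ FG FH; [exists H => //|exists G => //]; split.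
  split; first split.
  - by move=> x /domU[G FG]; have [[dA _ _ _] _] := FP _ FG; exact: dA.
  - move=> x y z [G FG Gx]; have [[_ dG _ _] _] := FP _ FG.
    by have [dy dz] := dG _ _ _ Gx; split; apply/domU; exists G.
  - move=> x y /domU[G FG Gx] /domU[H FH Hy].
    have [K FK [GK HK]] := common _ _ FG FH.
    have [[_ _ dK _] _] := FP _ FK.
    have [z Kz] := dK x y (domS _ _ GK _ Gx) (domS _ _ HK _ Hy).
    by exists z, K.
  - move=> p q z [G FG Gp] [H FH Hq].
    have [K FK [GK HK]] := common _ _ FG FH.
    have [[_ _ _ dK] _] := FP _ FK.
    exact: dK (GK _ Gp) (HK _ Hq).
  have [[G FG Gn0]|] := pselect (exists2 G, F G & G != set0).
    right; have [_ [G0|Gi]] := FP _ FG; first by rewrite G0 eqxx in Gn0.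
    by apply: sub_infinite_set Gi; apply: domS => x Gx; exists G.
  move=> nF; left; rewrite -subset0 => x [G FG Gx].
  by apply: nF; exists G => //; apply/set0P; exists x.
(* The empty graph is not maximal: a pairing of the naturals, carried into [A] by an injection,
   extends it. *)
have {Ginf} Dinf : infinite_set (dom G).
  case: Ginf => // G0; exfalso.
  have [x0 Ax0] := infinite_setN0 Ainf.
  have /infiniteP/(card_le_fun x0)[e [eA eI]] := Ainf.
  have /card_eqPle[/(card_le_fun 0)[h [_ hI]] _] := card_nat2.
  pose G1 : set ((T * T) * T) :=
    [set p | exists i j, p = ((e i, e j), e (h (i, j)))].
  have dom1 x : dom G1 x <-> exists i, x = e i.
    split=> [[y [z [i [j []]]]]|[i ->]]; first by move=> -> _ _; exists i.
    by exists (e i), (e (h (i, i))), i, i.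
  apply: (Gmax G1).
    by rewrite G0; split => // /(_ ((e 0, e 0), e (h (0, 0)))); apply; exists 0, 0.
  split; last first.
    right; apply/infiniteP.
    apply: (@card_le_of_inj _ _ _ _ e) => [i _|i j _ _]; last exact: eI.
    by apply/dom1; exists i.
  split.
  - by move=> x /dom1[i ->]; exact: eA.
  - move=> x y z [i [j [_ -> ->]]].
    by split; apply/dom1; [exists j|exists (h (i, j))].
  - by move=> x y /dom1[i ->] /dom1[j ->]; exists (e (h (i, j))), i, j.
  - move=> p q z [i [j [-> ->]]] [i' [j' [-> /eI-/(_ Logic.I Logic.I)]]].
    by move=> /hI-/(_ Logic.I Logic.I)[-> ->].
have [dA dG totG injG] := QG.
set D := dom G in Dinf.
have DD : D `*` D #<= D.
  apply: (@card_le_rel _ _ _ _ (fun p z => G (p, z))).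
    move=> [x y] [/= Dx Dy]; have [z Gz] := totG _ _ Dx Dy.
    by exists z; split => //; have [] := dG _ _ _ Gz.
  by move=> p q z _ _; exact: injG.
have [AD|DA] := card_le_total (A `\` D) D.
  have AD' : A #<= D.
    apply: card_le_trans (card_setU_le DD Dinf AD).
    by apply: subset_card_le; rewrite setDUK.
  apply: card_le_trans (card_le_setX AD' AD') _.
  by apply: card_le_trans DD _; exact: subset_card_le.
exfalso.
have [E EA DE] := card_le_subset DA.
pose D' := D `|` E.
have /card_eqPle[DleE EleD] := DE.
have [x0 Dx0] := infinite_setN0 Dinf.
have D'D : D' #<= D by exact: card_setU_le.
have D'E : D' `*` D' #<= E.
  apply: card_le_trans (card_le_setX D'D D'D) _.
  exact: card_le_trans DD DleE.
have [h [hE hI]] := card_le_fun x0 D'E.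
(* New values lie in [E] and old ones in [D], which are disjoint, so injectivity survives. *)
pose G' := G `|` [set p | [/\ (D' `*` D') p.1, ~ (D `*` D) p.1 & p.2 = h p.1]].
have ED x : E x -> ~ D x by move=> /EA[].
have GDD p z : G (p, z) -> (D `*` D) p /\ D z.
  case: p => x y Gp; have [? ?] := dG _ _ _ Gp.
  by split=> //; split => //; exists y, z.
have [e0 Ee0] : E !=set0.
  apply/set0P/eqP => E0; move: DleE; rewrite E0 => /card_le0P D0.
  by rewrite D0 in Dx0.
have dom' x : dom G' x <-> D' x.
  split=> [[y [z [Gx|[[/= Dx _] _ _]]]] //|].
    by left; exists y, z.
  move=> D'x; have [Dx|nDx] := pselect (D x).
    by apply: (domS G) => // p; left.
  exists x, (h (x, x)); right; split => //; last by case.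
apply: (Gmax G').
  split; first by move=> p; left.
  move=> /(_ ((x0, e0), h (x0, e0))) /(_ _)/GDD[|[_ /=] /(ED _ Ee0)//].
  by right; split => //=; [split; [left|right]|case=> _ /=; exact: ED].
split; last by right; apply: sub_infinite_set Dinf; apply: domS => p; left.
split.
- by move=> x /dom'[/dA//|/EA[]].
- move=> x y z [Gx|[[/= Dx Dy] nD ->]].
    by have [Dy Dz] := dG _ _ _ Gx; split; apply/dom'; left.
  by split; apply/dom' => //; right; exact: hE.
- move=> x y /dom' Dx /dom' Dy.
  have [[Dx' Dy']|nD] := pselect ((D `*` D) (x, y)).
    by have [z Gz] := totG _ _ Dx' Dy'; exists z; left.
  by exists (h (x, y)); right.
- move=> p q z [Gp|[/= D'p nDp ->]] [Gq|[/= D'q nDq zq]].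
  + exact: injG Gp Gq.
  + have [_ Dz] := GDD _ _ Gp; rewrite zq in Dz.
    by have /ED := hE _ D'q.
  + by have [_ /ED] := GDD _ _ Gq; case; exact: hE.
  + exact: hI.
Qed.

(** * Cofinal families of countable sets *)

Lemma card_le_surj (T U : Type) (t : T) (A : set T) (B : set U) :
  A #<= B -> exists e : U -> T, forall x, A x -> exists2 y, B y & e y = x.
Proof.
move=> AB.
have [->|/set0P[x0 Ax0]] := eqVneq A set0; first by exists (fun=> t).
have [u Bu] : B !=set0.
  by apply/set0P/eqP => B0; rewrite B0 in AB; move/card_le0P: AB Ax0 => ->.
have [f [fAB fI]] := card_le_fun u AB.
have /choice[e eP] y : exists x, forall x', A x' -> f x' = y -> x' = x.
  have [[x [Ax <-]]|ny] := pselect (exists x, A x /\ f x = y).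
    by exists x => x' Ax'; exact: fI.
  by exists t => x' Ax' fx'; exfalso; apply: ny; exists x'.
by exists e => x Ax; exists (f x); [exact: fAB|rewrite -(eP _ x)].
Qed.

(** For infinite [A], this bounds by |A| the cofinality of the countable subsets of [A] under
    inclusion. The sequences [c j] may leave [A]. *)
Definition countably_cofinal (T : Type) (A : set T) : Prop :=
  exists c : T -> nat -> T, forall s : nat -> T, (forall i, A (s i)) ->
    exists2 j, A j & forall i, exists k, s i = c j k.

Lemma countably_cofinal_index (T V : Type) (A : set T) (I : set V)
    (c : V -> nat -> T) :
  I #<= A ->
  (forall s : nat -> T, (forall i, A (s i)) ->
    exists2 j, I j & forall i, exists k, s i = c j k) ->
  countably_cofinal A.
Proof.
move=> IA cP.
have [A0|/set0P[x0 Ax0]] := eqVneq A set0.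
  by exists (fun t _ => t) => s /(_ 0); rewrite A0.
have [v _ _] := cP (fun=> x0) (fun=> Ax0).
have [e eP] := card_le_surj v IA.
exists (fun j => c (e j)) => s /cP[j /eP[y Ay <-] jk].
by exists y.
Qed.

Lemma card_eq_countably_cofinal (T U : Type) (A : set T) (B : set U) :
  A #= B -> countably_cofinal A -> countably_cofinal B.
Proof.
move=> /card_eqPle[AB BA] [c cP].
have [B0|/set0P[u0 Bu0]] := eqVneq B set0.
  by exists (fun t _ => t) => s /(_ 0); rewrite B0.
have [e eP] := card_le_surj u0 BA.
apply: (countably_cofinal_index (c := fun j k => e (c j k)) AB) => s sB.
have /choice[s' s'P] i : exists x, A x /\ e x = s i.
  by have [x Ax ex] := eP _ (sB i); exists x.
have [j Aj jk] := cP s' (fun i => (s'P i).1).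
exists j => // i; have [k e'] := jk i.
by exists k; rewrite -e' (s'P i).2.
Qed.

Lemma well_order_exists (T : Type) : exists R : T -> T -> Prop,
  (forall x y, R x y -> R y x -> x = y) /\
  (forall (P : set T) x, P x -> exists2 m, P m & forall y, P y -> R m y).
Proof.
elim/Peq: T => T; have [R Rwo] := well_ordering_principle T.
exists R; split=> [x y Rxy Ryx|P x Px].
  apply: (@wo_chain_antisymmetric T R predT _ x y) => //; last by rewrite Rxy.
  exact: withinW.
have [|m [[Pm lb] _]] := Rwo (fun x => `[< P x >]); first by exists x; apply/asboolP.
by exists m; [exact/asboolP|move=> y Py; apply: lb; apply/asboolP].
Qed.

(* A countable subset of [A] is bounded in a well-order of type |A| = |B|^+,
   hence lies in an initial segment, which embeds in [B]. *)
Lemma countably_cofinal_succ (T U : Type) (A : set T) (B : set U) :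
  infinite_set B -> countably_cofinal B -> B #<= A -> ~ (A #<= B) ->
  (forall C, C `<=` A -> ~ (A #<= C) -> C #<= B) ->
  countably_cofinal A.
Proof.
move=> Binf [c0 c0P] BA nAB succ.
have Ainf : infinite_set A by move/infiniteP: Binf => /card_le_trans/(_ BA)/infiniteP.
have [R [Ranti Rmin]] := well_order_exists T.
(* [A'] is the shortest initial segment of [A] of full cardinality, or [A] itself if no proper one
   is. Its proper initial segments are then smaller than [A], hence embed in [B]. *)
have [A' A'A [AA' seg]] : exists2 A' : set T, A' `<=` A &
    A #<= A' /\ forall y, A' y -> A' `&` [set x | ~ R y x] #<= B.
  pose P x := A #<= (A `&` [set y | ~ R x y]).
  have [[x Px]|nP] := pselect (exists x, P x); last first.
    exists A => //; split=> // y Ay; apply: succ; first by move=> x [].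
    by move=> Py; apply: nP; exists y.
  have [m Pm mmin] := Rmin P x Px.
  exists (A `&` [set y | ~ R m y]); first by move=> y [].
  split=> // y [Ay nmy]; apply: (@card_le_trans _ _ _ (A `&` [set x | ~ R y x])).
    by apply: subset_card_le => z [[]].
  by apply: succ => [z []//|Py]; apply: nmy; exact: mmin.
have A'_le_A := subset_card_le A'A.
have A'inf : infinite_set A' by move/infiniteP: Ainf => /card_le_trans/(_ AA')/infiniteP.
apply: (@card_eq_countably_cofinal _ _ A'); first exact/card_eqPle.
have [u0 Bu0] := infinite_setN0 Binf.
have [t0 A't0] := infinite_setN0 A'inf.
have BB := infinite_card_setX Binf.
(* An unbounded [s] would make [A'] a countable union of segments of size at most |B|, whence |A| <=
   |B|. *)
have bounded (s : nat -> T) : (forall i, A' (s i)) ->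
    exists2 a, A' a & forall i, R a (s i) -> a = s i.
  move=> sA'; apply: contrapT => nb; apply: nAB.
  apply: card_le_trans AA' _.
  apply: card_le_trans (card_setX_countable BB Binf).
  have /choice[g gP] i := card_le_fun u0 (seg _ (sA' i)).
  apply: (@card_le_rel _ _ _ _
    (fun x (p : nat * U) => ~ R (s p.1) x /\ p.2 = g p.1 x)).
    move=> x A'x; have /forall2NP/(_ x)[//|/existsNP[i /not_implyP[Rx nx]]] := nb.
    have nR : ~ R (s i) x by move=> Rs; apply: nx; exact: Ranti.
    by exists (i, g i x); split; [split => //=; apply: (gP i).1|split].
  move=> x x' [i y] A'x A'x' [/= Rx ->] [/= Rx' gxx'].
  by apply: ((gP i).2 _ _ _ _ gxx').
have /choice[d dP] a : exists d : U -> T,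
    A' a -> forall x, A' x -> ~ R a x -> exists2 y, B y & d y = x.
  have [/seg/(card_le_surj t0)[d dP]|nA'a] := pselect (A' a); last by exists (fun=> t0).
  by exists d => _ x A'x nR; apply: dP.
(* A bound [a] and an index [b] in [B] code a countable set. The value at 0 is [a] itself, since
   [d a] only reaches the points strictly below [a]. *)
apply: (@countably_cofinal_index _ _ A' (A' `*` B)
  (fun p k => if k is k'.+1 then d p.1 (c0 p.2 k') else p.1)).
  apply: card_le_trans (infinite_card_setX A'inf).
  by apply: card_le_setX => //; exact: card_le_trans AA'.
move=> s sA'; have [a A'a ba] := bounded s sA'.
have /choice[s' s'P] i : exists y, B y /\ (a <> s i -> d a y = s i).
  have [->|nas] := pselect (a = s i); first by exists u0.
  have [|y By dy] := dP a A'a (s i) (sA' i); first by move=> /ba/nas.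
  by exists y.
have [b Bb bk] := c0P s' (fun i => (s'P i).1).
exists (a, b) => // i; have [<-|nas] := pselect (a = s i); first by exists 0.
have [k e] := bk i.
by exists k.+1; rewrite /= -e (s'P i).2.
Qed.

(** * Sets of cardinality below aleph_omega *)

Lemma is_aleph_infinite n (T : Type) (B : set T) : is_aleph n B -> infinite_set B.
Proof.
elim: n T B => [|n IHn] T B /=.
  by move=> /card_eqPle[_ nB]; apply/infiniteP.
move=> [A [/IHn/infiniteP Ainf [[AB _] _]]].
by apply/infiniteP; exact: card_le_trans AB.
Qed.

Lemma card_eq_is_aleph n (T : Type) (A B : set T) :
  A #= B -> is_aleph n A -> is_aleph n B.
Proof.
case: n => [|n] /= AB; first exact: card_eq_trans (card_esym AB).
move=> [C [Cn [[CA nAC] min]]]; exists C; split => //.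
have /card_eqPle[leAB leBA] := AB.
split; first split; first exact: card_le_trans leAB.
  by move=> /(card_le_trans leAB).
move=> D DB [CD nDC].
have [D' D'A DD'] := card_le_subset (card_le_trans (subset_card_le DB) leBA).
have /card_eqPle[leDD' leD'D] := DD'.
apply: card_le_trans leBA _; apply: card_le_trans leD'D.
apply: min => //; split; first exact: card_le_trans leDD'.
by move=> /(card_le_trans leDD').
Qed.

(** For countable [A] a single enumeration suffices. At a successor, either [A] embeds in the
    previous aleph, or [A] has the successor cardinality and [countably_cofinal_succ] applies. *)
Lemma is_aleph_countably_cofinal n (T U : Type) (A : set T) (B : set U) :
  is_aleph n B -> A #<= B -> infinite_set A -> countably_cofinal A.
Proof.
elim: n T U A B => [|n IHn] T U A B.
  move=> /card_eqPle[/[swap] _ Bn] AB Ainf.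
  have [t0 At0] := infinite_setN0 Ainf.
  have [e eP] := card_le_surj t0 (card_le_trans AB Bn).
  exists (fun _ => e) => s sA; exists t0 => // i.
  by have [k _ <-] := eP _ (sA i); exists k.
move=> [B0 [B0n [[B0B nBB0] min]]] AB Ainf.
have [AB0|nAB0] := pselect (A #<= B0); first exact: IHn B0n AB0 Ainf.
have B0A : B0 #<= A by case: (card_le_total A B0).
have B0inf := is_aleph_infinite B0n.
apply: (countably_cofinal_succ B0inf _ B0A nAB0).
  exact: IHn B0n _ B0inf.
move=> C CA nAC; apply: contrapT => nCB0; apply: nAC.
have [D DB CD] := card_le_subset (card_le_trans (subset_card_le CA) AB).
have /card_eqPle[leCD leDC] := CD.
apply: card_le_trans AB _; apply: card_le_trans leDC; apply: min => //.
split; last by move=> /(card_le_trans leCD).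
by case: (card_le_total C B0) => // /card_le_trans; apply.
Qed.

(** By minimality of [W], a copy of [A] in [W] misses some aleph_n; comparability then puts [A]
    below that aleph_n. *)
Lemma card_lt_aleph_omega_countably_cofinal (T : Type) (A : set T) :
  card_lt_aleph_omega A -> infinite_set A -> countably_cofinal A.
Proof.
move=> [U [W [[Wabove Wmin] [AW nWA]]]] Ainf.
have [A' A'W AA'] := card_le_subset AW.
have /card_eqPle[leAA' leA'A] := AA'.
have /existsNP[n nA'n] : ~ above_alephs A'.
  by move=> /(Wmin _ A'W)/card_le_trans/(_ leA'A).
have [B [_ Bn]] := Wabove n.
apply: (is_aleph_countably_cofinal Bn) => //.
have [/(card_le_trans leAA')//|/card_le_subset[C CA' BC]] := card_le_total A' B.
by exfalso; apply: nA'n; exists C; split => //; exact: card_eq_is_aleph Bn.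
Qed.

(** * Spiked spaces *)

Lemma card_le_seq (T : Type) :
  infinite_set [set: T] -> [set: seq T] #<= [set: T].
Proof.
move=> Tinf; have [t0 _] := infinite_setN0 Tinf.
have [p [_ pI]] := card_le_fun t0 (infinite_card_setX Tinf).
have /infiniteP/(card_le_fun t0)[i [_ iI]] := Tinf.
have {}pI x y : p x = p y -> x = y by apply: pI.
have {}iI x y : i x = i y -> x = y by apply: iI.
(* Folding is injective only among lists of equal length, so the length is recorded as well. *)
pose code (s : seq T) := foldr (fun x acc => p (x, acc)) t0 s.
have codeI s s' : size s = size s' -> code s = code s' -> s = s'.
  by elim: s s' => [|x s IHs] [|x' s'] //= [ss] /pI[-> /(IHs _ ss) ->].
apply: (@card_le_of_inj _ _ _ _ (fun s => p (i (size s), code s))) => //.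
move=> s s' _ _ /pI[/iI]; exact: codeI.
Qed.

(** Domination is asked at every [n], not at almost every [n]; additive constants in the index set
    will make up for the difference. *)
Definition dominating (I : Type) (d : I -> nat -> nat) : Prop :=
  forall g : nat -> nat, exists i, forall n, g n <= d i n.

(** Diagonalisation along an injection of [I] into the naturals. *)
Lemma dominating_uncountable (I : Type) (d : I -> nat -> nat) :
  dominating d -> ~ countable [set: I].
Proof.
move=> dom /(card_le_fun 0)[h [_ hI]].
have /choice[g gP] n : exists v, forall i, h i = n -> d i n < v.
  have [[i hi]|nh] := pselect (exists i, h i = n).
    by exists (d i n).+1 => j; rewrite -hi => /hI->.
  by exists 0 => i hi; exfalso; apply: nh; exists i.
have [i /(_ (h i))] := dom g.
by rewrite leqNgt gP.
Qed.

Section star.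
Context {X : topologicalType}.

Lemma open_star (A : set X) (P : set (set X)) :
  (forall U, P U -> open U) -> open (star A P).
Proof. by move=> Po; apply: bigcup_open => B [/Po]. Qed.

Lemma omega_cover_star (F : nat -> set X) (U : nat -> set (set X)) :
  (forall n, open_cover (U n)) ->
  (forall D : set X, finite_set D -> exists n, D `<=` star (F n) (U n)) ->
  omega_cover (range (fun n => star (F n) (U n))).
Proof.
move=> Uc FP; split; last by move=> D /FP[n Dn]; eexists; split; first exists n.
split; first by move=> _ [n _ <-]; apply: open_star => B; exact: (Uc n).1.
apply/seteqP; split => // x _.
by have [n /(_ x erefl) ?] := FP _ (finite_set1 x); eexists; first exists n.
Qed.

(** Replacing each point of [F n] by a member of [U n] around it can only enlarge the star. *)
Lemma strongly_star_scheepers_star_scheepers :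
  strongly_star_scheepers X -> star_scheepers X.
Proof.
move=> ssX U Uc; have [F [Ffin [_ Fomega]]] := ssX U Uc.
have /choice[b bP] (p : nat * X) : exists B, U p.1 B /\ B p.2.
  by have : setT p.2 by []; rewrite -(Uc p.1).2 => -[B ? ?]; exists B.
exists (fun n => (fun x => b (n, x)) @` F n); split.
  move=> n; split; last exact: finite_image.
  by move=> _ [x _ <-]; exact: (bP (n, x)).1.
left; apply: omega_cover_star => // D /Fomega[_ [[n _ <-] DF]].
exists n => x /DF[B [UB [y [Fy By]]] Bx]; exists B => //; split=> //.
by exists y; split => //; exists (b (n, y)); [exists y|exact: (bP (n, y)).2].
Qed.

End star.

(* The features shared by [Psi(A)] and [N(Y)]: a closed discrete set of points
   [e b] with decreasing neighbourhood bases [O b m], in a separable space,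
   the other points forming a sigma-compact set. *)
Record spiked (X : topologicalType) (T : Type) (e : T -> X)
    (O : T -> nat -> set X) : Prop := {
  spike_open : forall b m, open (O b m);
  spike_mem : forall b m, O b m (e b);
  spike_anti : forall b m n, m <= n -> O b n `<=` O b m;
  spike_base : forall b U, open U -> U (e b) -> exists m, O b m `<=` U;
  spike_disj : forall b c, b <> c ->
    exists m, forall x, O b m x -> ~ O c 0 x;
  spike_off : forall z, ~ range e z -> exists W m,
    [/\ open W, W z & forall b x, O b m x -> ~ W x];
  spike_dense : exists q : nat -> X, forall b m, exists k, O b m (q k);
  spike_sigma : exists K : nat -> set X,
    [/\ forall m n, m <= n -> K m `<=` K n,
        forall z, ~ range e z -> exists n, K n z &
        forall n, cover_compact (K n)]
}.

(** * The equivalence for spiked spaces *)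

Section spiked.
Context {X : topologicalType} {T : choiceType} {e : T -> X}
  {O : T -> nat -> set X}.
Hypothesis sp : spiked e O.

(** Index the cover by points, with [x] in [f x]: the indices of a finite subcover form [G], because
    [f y] meets [G] at [y]. *)
Lemma cover_compact_star (K : set X) (P : set (set X)) :
  cover_compact K -> open_cover P -> exists2 G, finite_set G & K `<=` star G P.
Proof.
move=> Kc [Po PT].
have /choice[f fP] x : exists B, P B /\ B x.
  by have : setT x by []; rewrite -PT => -[B ? ?]; exists B.
have [|x _|D _ KD] := Kc X setT f.
- by move=> x _; exact: Po (fP x).1.
- by exists x => //; exact: (fP x).2.
eexists; first exact: (finite_fset D).
move=> x /KD[y Dy fyx]; exists (f y) => //; split; first exact: (fP y).1.
by exists y; split => //; exact: (fP y).2.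
Qed.

Lemma spiked_strongly_star_scheepers :
  (forall d : seq T * nat -> nat -> nat, ~ dominating d) ->
  strongly_star_scheepers X.
Proof.
move=> nodom U Uc.
have [q qP] := spike_dense sp.
have [K [Kmono Kcov Kc]] := spike_sigma sp.
have /choice[f fP] (p : T * nat) :
    exists k, exists B, [/\ U p.2 B, B (e p.1) & B (q k)].
  have : setT (e p.1) by []; rewrite -(Uc p.2).2 => -[B UB Be].
  have [m OB] := spike_base sp ((Uc p.2).1 _ UB) Be.
  by have [k Ok] := qP p.1 m; exists k, B; split => //; exact: OB.
(* The constant [p.2] turns failure of domination at some [n] into failure at arbitrarily large
   [n]. *)
pose d (p : seq T * nat) n := \max_(b <- p.1) f (b, n) + p.2.
have /existsNP[g gP] := nodom d.
have {}gP S v : exists n, \max_(b <- S) f (b, n) + v < g n.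
  apply: contrapT => nS; apply: gP; exists (S, v) => n.
  by rewrite leqNgt; apply/negP => ?; apply: nS; exists n.
have /choice[G GP] n : exists G, finite_set G /\ K n `<=` star G (U n).
  by have [G ? ?] := cover_compact_star (Kc n) (Uc n); exists G.
exists (fun n => q @` `I_(g n) `|` G n); split.
  move=> n; rewrite finite_setU; split; last exact: (GP n).1.
  exact: finite_image (finite_II _).
apply: omega_cover_star => // D /finite_seqP[s ->].
have /choice[h hP] x : exists p : option T * nat,
    if p.1 is Some b then e b = x else K p.2 x.
  have [[b _ ebx]|/Kcov[n Kx]] := pselect (range e x).
    by exists (Some b, 0).
  by exists (None, n).
pose N := \max_(x <- s) (h x).2.
(* The constant exceeds or equals every [g k] with [k < N], which forces [N <= n], so [K n] contains
   all points of [D] off the spikes. *)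
have [n gn] := gP (pmap (fun x => (h x).1) s) (\max_(k < N) g k).
have Nn : N <= n.
  rewrite leqNgt; apply/negP => nN.
  suff : g n < g n by rewrite ltnn.
  apply: leq_ltn_trans gn; apply: leq_trans (leq_addl _ _).
  exact: (leq_bigmax (Ordinal nN)).
exists n => x /= sx; have := hP x; case hx : (h x) => [[b|] N'] /=.
  move=> <-; have [B [UB Beb Bq]] := fP (b, n).
  exists B => //; split => //; exists (q (f (b, n))); split=> //.
  left; exists (f (b, n)) => //=; apply: leq_ltn_trans gn.
  apply: leq_trans (leq_addr _ _).
  apply: (@leq_bigmax_seq _ _ _ (fun b => f (b, n))) => //.
  by rewrite mem_pmap; apply/mapP; exists x => //; rewrite hx.
move=> KN'x; have {KN'x} Kx : K n x.
  apply: Kmono KN'x; apply: leq_trans Nn.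
  have -> : N' = (h x).2 by rewrite hx.
  exact: (@leq_bigmax_seq _ _ _ (fun x => (h x).2)).
have [B [UB [y [Gy By]]] Bx] := (GP n).2 _ Kx.
by exists B => //; split => //; exists y; split => //; right.
Qed.

(* A point [e b] escapes all the stars as soon as [b] codes a countable set
   containing the indices of the spikes used and a function dominating the
   data of the choice; such codes exist when [T] is cofinal enough. *)
Lemma spiked_not_star_scheepers (d : T -> nat -> nat) :
  [set: T] `*` [set: T] #<= [set: T] -> countably_cofinal [set: T] ->
  dominating d -> ~ star_scheepers X.
Proof.
move=> TT [c cP] dom sX.
have nT := dominating_uncountable dom.
have [t0 _] : [set: T] !=set0.
  by apply/set0P/eqP => T0; apply: nT; rewrite T0.
(* A point codes a triple: the index [j] of a countable set, the index [t] of a function, and a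
   padding coordinate giving uncountably many codes for the same [(j, t)]. *)
have [p [_ pI]] : exists p : T * (T * T) -> T,
    (forall x, (setT `*` (setT `*` setT)) x -> setT (p x)) /\
    (forall x y, (setT `*` (setT `*` setT)) x -> (setT `*` (setT `*` setT)) y ->
       p x = p y -> x = y).
  apply: card_le_fun => //; apply: card_le_trans (TT).
  exact: card_le_setX (card_lexx _) TT.
have {}pI x y : p x = p y -> x = y by apply: pI.
have /choice[h hP] b : exists jt : T * T,
    forall j t x, p (j, (t, x)) = b -> jt = (j, t).
  have [[[j [t x]] pb]|nb] := pselect (exists x, p x = b).
    by exists (j, t) => j' t' x'; rewrite -pb => /pI[-> -> _].
  by exists (t0, t0) => j t x pb; exfalso; apply: nb; exists (j, (t, x)).
(* Otherwise all paddings of [(j, t)] would lie in the countable range of [c j], making [T]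
   countable. *)
have fresh j t : exists b, h b = (j, t) /\ forall k, b <> c j k.
  apply: contrapT => nb; apply: nT.
  apply: (@card_le_rel _ _ _ _ (fun x k => p (j, (t, x)) = c j k)).
    move=> x _; apply: contrapT => nx; apply: nb; exists (p (j, (t, x))).
    by split; [exact: hP|move=> k pk; apply: nx; exists k].
  by move=> x x' k _ _ <- /pI[].
have /choice[m mP] (b : T * T) : exists m,
    b.1 <> b.2 -> forall x, O b.1 m x -> ~ O b.2 0 x.
  have [e12|/(spike_disj sp)[m ?]] := pselect (b.1 = b.2); first by exists 0.
  by exists m.
have O0 b n : O b n `<=` O b 0 by exact: (spike_anti sp).
have eO b b' n : O b' n (e b) -> b' = b.
  move=> /O0 Oeb; apply: contrapT => /nesym bb'.
  by apply: (mP (b, b') bb' (e b)) => //; exact: (spike_mem sp).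
(* The level [(W z).2] works for all spikes at once, so bounding it needs no knowledge of [b]. *)
have /choice[W WP] z : exists Wm : set X * nat, ~ range e z ->
    [/\ open Wm.1, Wm.1 z & forall b x, O b Wm.2 x -> ~ Wm.1 x].
  have [ez|/(spike_off sp)[W [n ?]]] := pselect (range e z).
    by exists (setT, 0).
  by exists (W, n).
(* If [b] codes [(j, t)], the level is at least [M = d t n], to avoid the sets [W z] of level at
   most [M], and large enough to avoid the spikes [c j k] with [k <= M], hence [M.+1]. *)
pose F n b := let M := d (h b).2 n in
  maxn M (\max_(k < M.+1) m (b, c (h b).1 k)).
pose U n : set (set X) := range (fun b => O b (F n b)) `|`
  [set B | exists2 z, ~ range e z & B = (W z).1].
have Uc n : open_cover (U n).
  split; first by move=> _ [[b _ <-]|[z /WP[Wo _ _] ->]] //; exact: (spike_open sp).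
  apply/seteqP; split => // x _.
  have [[b _ <-]|nx] := pselect (range e x).
    by exists (O b (F n b)); [left; exists b|exact: (spike_mem sp)].
  by exists (W x).1; [right; exists x|have [] := WP _ nx].
have [V [VU Vstar]] := sX U Uc.
have /choice[s sP] n : exists s : seq (set X), V n = [set` s].
  by apply/finite_seqP; exact: (VU n).2.
have /choice[a aP] (nB : nat * set X) : exists a : T * X, U nB.1 nB.2 ->
    nB.2 = O a.1 (F nB.1 a.1) \/ (~ range e a.2 /\ nB.2 = (W a.2).1).
  have [[[b _ Ob]|[z nz Wz]]|nU] := pselect (U nB.1 nB.2).
  - by exists (b, e t0) => _; left.
  - by exists (t0, z) => _; right.
  - by exists (t0, e t0).
pose at_ (n k : nat) := a (n, nth set0 (s n) k).
(* One sequence lists the spikes used by all [V n], through a coding of the pairs [(n, k)]. *)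
pose sigma i := if unpickle i is Some (n, k) then (at_ n k).1 else t0.
have [j _ /choice[kappa kappaP]] := cP sigma (fun=> Logic.I).
(* At [n], [d t] bounds both the positions in [c j] of the spikes used by [V n] and the levels of
   its sets [W z]. *)
have [t tP] := dom (fun n => \max_(k < size (s n))
  maxn (kappa (pickle (n, k : nat))) (W (at_ n k).2).2).
have [b [hb bc]] := fresh j t.
have notin n : ~ star (\bigcup_(B in V n) B) (U n) (e b).
  move=> [B [UB [y [[B' VB' B'y] By]]] Beb].
  (* The only member of [U n] containing [e b] is [O b (F n b)]. *)
  have Oy : O b (F n b) y.
    case: UB By Beb => [[b' _ <-] Oy /eO <- //|[z nz ->] _ Wb].
    by have [_ _ /(_ b (e b) (spike_mem sp b _))] := WP z nz.
  have [k ks B'k] : exists2 k, k < size (s n) & B' = nth set0 (s n) k.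
    move: VB'; rewrite sP /= => B's; exists (index B' (s n)); first by rewrite index_mem.
    by rewrite nth_index.
  have := leq_trans (leq_bigmax (Ordinal ks)) (tP n).
  rewrite /= geq_max => /andP[kd Wd].
  have FM : d t n <= F n b by rewrite /F hb /= leq_maxl.
  have := aP (n, B') ((VU n).1 _ VB').
  rewrite B'k -/(at_ n k) /= -B'k => -[B'O|[nz B'W]].
    have ck : (at_ n k).1 = c j (kappa (pickle (n, k))).
      by rewrite -kappaP /sigma pickleK.
    rewrite B'O in B'y; apply: (mP (b, (at_ n k).1) _ y) (O0 _ _ _ B'y).
      by rewrite /= ck; exact: bc.
    apply: (spike_anti sp) Oy.
    rewrite /F hb /= ck; apply: leq_trans (leq_maxr _ _).
    by rewrite -ltnS in kd; exact: (leq_bigmax (Ordinal kd)).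
  have [_ _ /(_ b y)] := WP _ nz; rewrite -B'W; apply => //.
  by apply: (spike_anti sp) Oy; exact: leq_trans Wd FM.
case: Vstar => [[_ /(_ [set e b] (finite_set1 _))[_ [[n _ <-] /(_ _ erefl)]]]|[n Vn]].
  exact: notin.
by apply: (notin n); rewrite Vn.
Qed.

(** A dominating family indexed by [seq T * nat] forces [T] to be uncountable; the index set then
    has size at most |T|, and the family can be reindexed by [T]. *)
Lemma spiked_star_scheepers_iff : card_lt_aleph_omega [set: T] ->
  (star_scheepers X <-> strongly_star_scheepers X).
Proof.
move=> Tomega; split; last exact: strongly_star_scheepers_star_scheepers.
move=> sX; apply: spiked_strongly_star_scheepers => d dom.
have Tunc : ~ countable [set: T].
  move=> /(card_le_fun 0)[h [_ hI]]; apply: (dominating_uncountable dom).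
  apply: (@card_le_trans _ _ _ [set: seq nat * nat]); last exact: countableP.
  apply: (@card_le_of_inj _ _ _ _ (fun p => (map h p.1, p.2))) => //.
  have {}hI : injective h by move=> x y; apply: hI.
  by move=> [s n] [s' n'] _ _ /= [/(inj_map hI) -> ->].
have Tinf : infinite_set [set: T] by move=> /finite_set_countable.
have [t0 _] := infinite_setN0 Tinf.
have TT := infinite_card_setX Tinf.
have : [set: seq T * nat] #<= [set: T].
  rewrite -setXTT; apply: card_le_trans TT.
  by apply: card_le_setX; [exact: card_le_seq|exact/infiniteP].
move=> /(card_le_surj ([::], 0))[h hP].
apply: (spiked_not_star_scheepers (d := d \o h)) => //.
  exact: card_lt_aleph_omega_countably_cofinal.
move=> g; have [i gi] := dom g; have [t _ hti] := hP i Logic.I.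
by exists t => n /=; rewrite hti.
Qed.

End spiked.

(** * Isbell-Mrowka spaces *)

Lemma card_eq_lt_aleph_omega (T U : Type) (A : set T) (B : set U) :
  A #= B -> card_lt_aleph_omega A -> card_lt_aleph_omega B.
Proof.
move=> /card_eqPle[AB BA] [V [W [Womega [AW nWA]]]].
exists V, W; split => //; split; first exact: card_le_trans AW.
by move=> /card_le_trans/(_ BA).
Qed.

Lemma finite_cover_compact (X : topologicalType) (A : set X) :
  finite_set A -> cover_compact A.
Proof.
move=> Afin I D f _ Acov.
have [A0|/set0P[x0 Ax0]] := eqVneq A set0.
  by exists finmap.fset0 => //; rewrite A0.
have [i0 _ _] := Acov _ Ax0.
have /choice[g gP] x : exists i, A x -> D i /\ f i x.
  by have [/Acov[i Di fx]|] := pselect (A x); [exists i|exists i0].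
have gA := finite_image g Afin.
exists (fset_set (g @` A)) => [i|x Ax].
  by rewrite in_fset_set// inE => -[x /gP[Di _] <-]; rewrite inE.
exists (g x) => /=; last by have [] := gP x Ax.
by rewrite in_fset_set// inE; exists x.
Qed.

Lemma finite_set_nat_bounded (A : set nat) :
  finite_set A -> exists m, A `<=` `I_m.
Proof.
move=> /finite_seqP[s ->]; exists (\max_(i <- s) i).+1 => i si /=.
exact: (@leq_bigmax_seq _ _ _ id).
Qed.

Section isbell_mrowka.
Variable A : set (set nat).

Lemma open_isbell_mrowkaE (U : set (isbell_mrowka A)) :
  open U = isbell_mrowka_open U.
Proof. by []. Qed.

(** The naturals are both the dense sequence and the sigma-compact part, exhausted by finite sets.
    Almost disjointness separates the spikes. *)
Lemma isbell_mrowka_spiked : almost_disjoint A ->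
  @spiked (isbell_mrowka A) A (@IMset A)
    (fun a m => isbell_mrowka_basic (IMset a) `I_m).
Proof.
move=> [Ainf Aad].
have openW k : open [set @IMnat A k].
  by rewrite open_isbell_mrowkaE => _ ->; exists set0; split => //; exact: finite_set0.
split.
- move=> a m; rewrite open_isbell_mrowkaE => _ [->|[k ak <-]].
    by exists `I_m; split => //; exact: finite_II.
  by exists set0; split; [exact: finite_set0|move=> _ ->; right; exists k].
- by move=> a m; left.
- move=> a m n mn x [->|[k [ak nk] <-]]; first by left.
  by right; exists k => //; split => //= km; apply: nk; exact: leq_trans mn.
- move=> a U; rewrite open_isbell_mrowkaE => oU /oU[F [/finite_set_nat_bounded[m Fm] FU]].
  exists m => x [->|[k [ak nk] <-]]; apply: FU; first by left.
  by right; exists k => //; split => // /Fm.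
- move=> a c ac.
  have [|m acm] := @finite_set_nat_bounded (set_val a `&` set_val c).
    apply: Aad; [exact: set_valP|exact: set_valP|].
    by move=> e; apply: ac; exact: val_inj.
  exists m => _ [->|[k [ak nk] <-]] [] //; first by move=> [].
    by move=> [].
  by move=> [k' [ck' _] [kk']]; apply: nk; apply: acm; split => //; rewrite -kk'.
- move=> [a|k] nz; first by exfalso; apply: nz; exists a.
  exists [set IMnat k], k.+1; split => // a x [->//|[i [ai ni] <-]] [ik].
  by apply: ni => /=; rewrite ik.
- exists IMnat => a m.
  have [k amk] : (set_val a `\` `I_m) !=set0.
    apply: infinite_setN0; apply: infinite_setD; last exact: finite_II.
    exact: Ainf (set_valP a).
  by exists k; right; exists k.
- exists (fun n => IMnat @` `I_n); split.
  + by move=> m n mn _ [k km <-]; exists k => //=; exact: leq_trans mn.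
  + move=> [a|k] nz; first by exfalso; apply: nz; exists a.
    by exists k.+1, k => //=.
  + by move=> n; apply: finite_cover_compact; exact: finite_image (finite_II _).
Qed.

End isbell_mrowka.

(** * Niemytzki planes *)

Import Order.TTheory GRing.Theory Num.Theory.
Import numFieldTopology.Exports.

Local Open Scope ring_scope.

Section archimedean.
Variable R : realType.

Lemma exists_invSn_le (r : R) : 0 < r -> exists m : nat, m.+1%:R^-1 <= r.
Proof.
move=> r0; exists (Num.bound r^-1).
have rb : r^-1 < (Num.bound r^-1).+1%:R :> R.
  apply: lt_le_trans (archi_boundP _) _; first by rewrite invr_ge0 ltW.
  by rewrite ler_nat.
by rewrite -[leRHS]invrK lef_pV2 ?posrE ?invr_gt0 ?ltr0n// ltW.
Qed.

Lemma exists_nat_ge (x : R) : exists n : nat, x <= n%:R.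
Proof.
exists (Num.bound `|x|); apply: le_trans (ler_norm x) _.
by apply: ltW; apply: archi_boundP.
Qed.

Lemma norm_le_sqr (x s : R) : 0 < s -> x ^+ 2 <= s ^+ 2 -> `|x| <= s.
Proof.
by move=> /ltW s0; rewrite -[x ^+ 2]real_normK ?num_real // ler_sqr ?nnegrE.
Qed.

End archimedean.

Section niemytzki.
Variables (R : realType) (Y : set R).
Local Notation N := (niemytzki Y).
Local Notation pt := (@niemytzki_pt R Y).

Lemma niemytzki_pt_inj : injective pt.
Proof.
by move=> [p Pp] [q Pq] /= pq; subst q; rewrite (Prop_irrelevance Pp Pq).
Qed.

Lemma open_niemytzkiE (U : set N) : open U = niemytzki_open U.
Proof. by []. Qed.

Lemma euclidean_disc_center (c : R * R) r : 0 < r -> euclidean_disc c r c.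
Proof. by rewrite /euclidean_disc /= => r0; nra. Qed.

Lemma euclidean_disc_sub (c w : R * R) r : 0 < r -> euclidean_disc c r w ->
  exists2 s, 0 < s & euclidean_disc w s `<=` euclidean_disc c r.
Proof.
move: c w => [c1 c2] [w1 w2]; rewrite /euclidean_disc /= => r0 wr.
pose D := r ^+ 2 - ((w1 - c1) ^+ 2 + (w2 - c2) ^+ 2).
have D0 : 0 < D by rewrite subr_gt0.
(* Expanding around [w], the two cross terms contribute at most [4 * s * r] and the squares less
   than [s ^+ 2 <= s * r], in total less than [5 * s * r = D]. *)
exists (D / (5 * r)); first by rewrite divr_gt0 // mulr_gt0.
set s := D / (5 * r).
have s0 : 0 < s by rewrite divr_gt0 // mulr_gt0.
have sr : 5 * r * s = D by rewrite mulrC divfK // mulf_neq0 ?lt0r_neq0.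
have sler : s <= r.
  rewrite ler_pdivrMr ?mulr_gt0 // /D.
  have := sqr_ge0 (w1 - c1); have := sqr_ge0 (w2 - c2).
  have : 0 < r * r by rewrite mulr_gt0.
  rewrite !expr2; lra.
move=> [z1 z2] /= zs.
have norms (a b t : R) : 0 < t -> a ^+ 2 + b ^+ 2 < t ^+ 2 -> `|a| <= t /\ `|b| <= t.
  by move=> t0 ab; have := sqr_ge0 a; have := sqr_ge0 b;
     split; apply: norm_le_sqr => //; lra.
have [z1s z2s] := norms _ _ _ s0 zs.
have [w1r w2r] := norms _ _ _ r0 wr.
have p1 : (z1 - w1) * (w1 - c1) <= s * r.
  by apply: le_trans (ler_norm _) _; rewrite normrM ler_pM.
have p2 : (z2 - w2) * (w2 - c2) <= s * r.
  by apply: le_trans (ler_norm _) _; rewrite normrM ler_pM.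
have -> : z1 - c1 = (z1 - w1) + (w1 - c1) by rewrite subrKA.
have -> : z2 - c2 = (z2 - w2) + (w2 - c2) by rewrite subrKA.
have ss : s ^+ 2 <= s * r by rewrite expr2 ler_pM2l.
rewrite -/s in zs; rewrite /D in sr.
lra.
Qed.

Lemma open_niemytzki_disc (c : R * R) r : 0 < r ->
  open [set z : N | 0 < (pt z).2 /\ euclidean_disc c r (pt z)].
Proof.
move=> r0; rewrite open_niemytzkiE => z [z0 /(euclidean_disc_sub r0)[s s0 sub]].
by exists s; split => //; rewrite /niemytzki_basic z0 => w [w0 /sub].
Qed.

Definition axis_point (y : Y) : N :=
  @Niemytzki R Y (set_val y, 0) (or_intror (conj erefl (set_valP y))).

Lemma niemytzki_basic_axis (y : Y) (r : R) : niemytzki_basic (axis_point y) r =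
  axis_point y |` [set z | euclidean_disc (set_val y, r) r (pt z)].
Proof. by rewrite /niemytzki_basic /= ltxx. Qed.

Lemma not_axis_pointP (z : N) : ~ range axis_point z <-> 0 < (pt z).2.
Proof.
split=> [nz|z0 [y _ yz]]; last by move: z0; rewrite -yz /= ltxx.
case: (niemytzki_ptP z) => // -[z2 Yz]; exfalso; apply: nz.
have [y yz] : exists y : Y, set_val y = (pt z).1.
  by exists (exist _ (pt z).1 (mem_set Yz)).
exists y => //; apply: niemytzki_pt_inj => /=.
by rewrite yz -z2; case: (pt z).
Qed.

(** The disc inequality amounts to [(p.1 - y) ^+ 2 < p.2 * (2 * r - p.2)]. *)
Lemma tangent_disc_gt0 (y r : R) (p : R * R) :
  0 < r -> euclidean_disc (y, r) r p -> 0 < p.2 /\ p.2 < 2 * r.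
Proof.
rewrite /euclidean_disc /= => r0 pr.
have pp : 0 < p.2 * (2 * r - p.2) by have := sqr_ge0 (p.1 - y); lra.
have p0 : 0 < p.2 by rewrite ltNge; apply/negP => p0; nra.
by split => //; move: pp; rewrite pmulr_rgt0 // subr_gt0.
Qed.

Lemma tangent_disc_le (y r s : R) (p : R * R) : 0 < r -> r <= s ->
  euclidean_disc (y, r) r p -> euclidean_disc (y, s) s p.
Proof.
move=> r0 rs pr; have [p0 _] := tangent_disc_gt0 r0 pr.
by move: pr; rewrite /euclidean_disc /=; nra.
Qed.

(** A common point has height below [2 * r], so both horizontal distances have square below [4 * r];
    the parallelogram identity gives [(b - c) ^+ 2 < 16 * r]. *)
Lemma tangent_disc_disjoint (b c r : R) (p : R * R) : 0 < r -> r <= 1 ->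
  16 * r <= (b - c) ^+ 2 ->
  euclidean_disc (b, r) r p -> ~ euclidean_disc (c, 1) 1 p.
Proof.
move=> r0 r1 rbc pb pc.
have [p0 pr] := tangent_disc_gt0 r0 pb.
move: pb pc; rewrite /euclidean_disc /= => pb pc.
have ub : (p.1 - b) ^+ 2 < 4 * r by have := sqr_ge0 (p.2 - r); nra.
have vb : (p.1 - c) ^+ 2 < 4 * r by have := sqr_ge0 p.2; lra.
have := sqr_ge0 ((p.1 - b) + (p.1 - c)).
lra.
Qed.

Local Notation radius m := ((m.+1)%:R^-1 : R).

Lemma radius_gt0 m : 0 < radius m.
Proof. by rewrite invr_gt0 ltr0n. Qed.

Lemma radius_anti m n : (m <= n)%N -> radius n <= radius m.
Proof. by move=> mn; rewrite lef_pV2 ?posrE ?ltr0n// ler_nat. Qed.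

Lemma open_tangent_nbhd (y : Y) r : 0 < r -> open (niemytzki_basic (axis_point y) r).
Proof.
move=> r0; rewrite open_niemytzkiE => z; rewrite niemytzki_basic_axis => -[->|zr].
  by exists r; split; rewrite // niemytzki_basic_axis.
have [s s0 sub] := euclidean_disc_sub r0 zr.
exists s; split => //.
have [z0 _] := tangent_disc_gt0 r0 zr.
by rewrite /niemytzki_basic z0 => w [_ /sub]; right.
Qed.

Definition niemytzki_rect (n : nat) : set N :=
  pt @^-1` (`[- n%:R, n%:R] `*` `[radius n, n%:R]).

(** Above the axis the topology is Euclidean, which lets compactness of rectangles be imported from
    the plane. *)
Lemma open_pt_image (U : set N) : open U ->
  open [set p : R * R | exists z, [/\ pt z = p, 0 < p.2 & U z]].
Proof.
rewrite open_niemytzkiE => Uo; rewrite openE => -[p1 p2] [z [zp /= p0 Uz]].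
have [r [r0 rU]] := Uo _ Uz.
rewrite /niemytzki_basic zp p0 in rU.
(* Balls are squares here: half-side [r / 2] fits in the disc of radius [r], and [p2] keeps the
   square above the axis. *)
apply/nbhs_ballP; exists (Num.min (r / 2) p2) => /=.
  by rewrite lt_min p0 divr_gt0.
move=> [q1 q2] [/=]; rewrite -!ball_normE /= !lt_min.
move=> /andP[pq1 _] /andP[pq2 pq3].
have q0 : 0 < q2 by move: pq3; rewrite ltr_norml; lra.
exists (@Niemytzki R Y (q1, q2) (or_introl q0)); split => //.
apply: rU; split => //=; rewrite /euclidean_disc /=.
move: pq1 pq2; rewrite !ltr_norml => /andP[? ?] /andP[? ?]; nra.
Qed.

Lemma niemytzki_rect_compact n : cover_compact (niemytzki_rect n).
Proof.
move=> I D f fo fcov.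
pose RR : ptopologicalType := HB.pack (R * R)%type.
have : @compact RR (`[- n%:R : R, n%:R] `*` `[radius n, n%:R]).
  by apply: compact_setX; exact: segment_compact.
rewrite compact_cover.
move=> /(_ I D (fun i => [set p | exists z, [/\ pt z = p, 0 < p.2 & f i z]])).
case.
- by move=> i /fo; exact: open_pt_image.
- move=> p pK; have p0 : 0 < p.2.
    case: pK => _ /=; rewrite in_itv /= => /andP[h _].
    exact: lt_le_trans (radius_gt0 n) h.
  pose z := @Niemytzki R Y p (or_introl p0).
  by have [i Di fi] := fcov z pK; exists i => //; exists z.
- move=> D' D'D cov; exists D' => // z /cov[i D'i [z' [/niemytzki_pt_inj <- _ fz]]].
  by exists i.
Qed.

Lemma niemytzki_spiked :
  spiked axis_point (fun y m => niemytzki_basic (axis_point y) (radius m)).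
Proof.
split.
- by move=> y m; exact: open_tangent_nbhd (radius_gt0 m).
- by move=> y m; rewrite niemytzki_basic_axis; left.
- move=> y m n mn z; rewrite !niemytzki_basic_axis => -[->|zn]; [by left|right].
  exact: tangent_disc_le (radius_gt0 n) (radius_anti mn) zn.
- move=> y U; rewrite open_niemytzkiE => oU /oU[r [r0 rU]].
  have [m mr] := exists_invSn_le r0.
  exists m => z zm; apply: rU; move: zm.
  rewrite !niemytzki_basic_axis => -[->|zm]; [by left|right].
  exact: tangent_disc_le (radius_gt0 m) mr zm.
- move=> b c bc.
  have bc' : set_val b <> set_val c by move=> /val_inj.
  have bc0 : 0 < (set_val b - set_val c) ^+ 2 / 16.
    by rewrite divr_gt0 // exprn_even_gt0 //= subr_eq0; apply/eqP.
  have [m mbc] := exists_invSn_le bc0.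
  have r1 : radius m <= 1 by rewrite invf_le1 ?ltr0n // ler1n.
  have r0 := radius_gt0 m.
  exists m => z; rewrite !niemytzki_basic_axis invr1 => -[->|zb] [zc|zc].
  + by apply: bc'; case: (congr1 pt zc).
  + by move: zc; rewrite /euclidean_disc /=; nra.
  + by move: zb; rewrite zc => /(tangent_disc_gt0 r0)[/=]; rewrite ltxx.
  + by apply: (tangent_disc_disjoint r0 r1 _ zb zc); rewrite mulrC -ler_pdivlMr.
- move=> z /not_axis_pointP z0.
  (* Tangent discs of radius at most a quarter of the height of [z] stay below half that height,
     while the disc around [z] of radius half the height stays above it. *)
  have z4 : 0 < (pt z).2 / 4 by rewrite divr_gt0.
  have [m mz] := exists_invSn_le z4.
  have z2 : 0 < (pt z).2 / 2 by rewrite divr_gt0.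
  exists [set w | 0 < (pt w).2 /\ euclidean_disc (pt z) ((pt z).2 / 2) (pt w)], m.
  split; first exact: open_niemytzki_disc.
    by split => //; exact: euclidean_disc_center.
  move=> y w; rewrite niemytzki_basic_axis => -[->[]|wy [w0 wz]] /=; first by rewrite ltxx.
  have [_ w2] := tangent_disc_gt0 (radius_gt0 m) wy.
  (* With [h] the height of [z], the product is [((pt w).2 - h) ^+ 2 - (h / 2) ^+ 2]. *)
  have ww : 0 < ((pt z).2 / 2 - (pt w).2) * ((pt z).2 * (3 / 2) - (pt w).2).
    by move: mz w2; set r := radius m => mz w2; apply: mulr_gt0; lra.
  by move: wz; rewrite /euclidean_disc /=; have := sqr_ge0 ((pt w).1 - (pt z).1); lra.
(* [q] enumerates the rational points of the upper half-plane, with [(0, 1)] as a default. *)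
- have /choice[q qP] k : exists z : N, forall p : rat * rat,
      unpickle k = Some p -> 0 < ratr p.2 :> R -> pt z = (ratr p.1, ratr p.2).
    case kp : (unpickle k) => [p|]; last first.
      by exists (@Niemytzki R Y (0, 1) (or_introl ltr01)).
    have [p0|np0] := pselect (0 < ratr p.2 :> R).
      by exists (@Niemytzki R Y (ratr p.1, ratr p.2) (or_introl p0)) => _ [<-].
    by exists (@Niemytzki R Y (0, 1) (or_introl ltr01)) => _ [<-].
  exists q => y m; have r0 := radius_gt0 m; set r := radius m in r0 *.
  (* Both coordinates are taken within [r / 2] of the centre [(y, r)], so the squared distance is
     below [r ^+ 2 / 2]. *)
  have [|u] := @rat_in_itvoo R (set_val y - r / 2) (set_val y + r / 2); first by lra.
  have [|v] := @rat_in_itvoo R (r / 2) (r + r / 2); first by lra.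
  rewrite !in_itv /= => /andP[v1 v2] /andP[u1 u2].
  exists (pickle (u, v)); rewrite niemytzki_basic_axis; right => /=.
  rewrite (qP _ (u, v)) /= ?pickleK //; last by lra.
  by rewrite /euclidean_disc /=; nra.
- exists niemytzki_rect; split; last exact: niemytzki_rect_compact.
  + move=> m n mn z [/=]; rewrite /niemytzki_rect /= !in_itv /= => z1 /andP[h1 h2].
    have mn' : (m%:R : R) <= n%:R by rewrite ler_nat.
    split.
      by rewrite -ler_norml; apply: le_trans mn'; rewrite ler_norml.
    by rewrite (le_trans (radius_anti mn) h1) (le_trans h2 mn').
  + move=> z /not_axis_pointP z0.
    have [m1 h1] := exists_invSn_le z0.
    have [m2 h2] := exists_nat_ge `|(pt z).1|.
    have [m3 h3] := exists_nat_ge (pt z).2.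
    have nat_le (i j : nat) : (i <= j)%N -> (i%:R : R) <= j%:R by rewrite ler_nat.
    exists (m1 + m2 + m3)%N; rewrite /niemytzki_rect /=.
    have k1 := @radius_anti m1 (m1 + m2 + m3) (leq_trans (leq_addr _ _) (leq_addr _ _)).
    have k2 := @nat_le m2 (m1 + m2 + m3)%N (leq_trans (leq_addl _ _) (leq_addr _ _)).
    have k3 := @nat_le m3 (m1 + m2 + m3)%N (leq_addl _ _).
    have := le_trans h2 k2; rewrite ler_norml => z1.
    split; rewrite /= in_itv //=.
    by rewrite (le_trans k1 h1) (le_trans h3 k3).
Qed.

End niemytzki.

Theorem theorem3p25 (R : realType) :
  (forall A : set (set nat), almost_disjoint A -> card_lt_aleph_omega A ->
     (star_scheepers (isbell_mrowka A) <->
      strongly_star_scheepers (isbell_mrowka A))) /\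
  (forall Y : set R, card_lt_aleph_omega Y ->
     (star_scheepers (niemytzki Y) <->
      strongly_star_scheepers (niemytzki Y))).
Proof.
split=> [A Aad Aomega|Y Yomega].
  apply: (spiked_star_scheepers_iff (isbell_mrowka_spiked Aad)).
  exact: card_eq_lt_aleph_omega (card_setT_sym A) Aomega.
apply: (spiked_star_scheepers_iff (niemytzki_spiked Y)).
exact: card_eq_lt_aleph_omega (card_setT_sym Y) Yomega.
Qed.
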